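(* For all integers $t,n\ge 2$ we have $R_{sep}(t,n)=2(t(n-1)+1)$.
   Context: The ordered complete graph on $[m]=\{1,\dots,m\}$ is the complete graph with vertex set $[m]$, taken with its natural ordering; edges are written $(i,j)$ with $i<j$. Two edges are independent if they share no vertex; independent edges $(a,b)$ and $(c,d)$ are separated if $a<b<c<d$ or $c<d<a<b$. A matching is a set of pairwise independent edges; it is separated if any two of its edges are separated, and monochromatic if all its edges have the same color. $R_{sep}(t,n)$ denotes the smallest $m$ such that in every coloring of the edges of the ordered complete graph on $[m]$ with $t$ colors there is a monochromatic separated matching with $n$ edges. *)

(* Defs.v *)
From mathcomp Require Import all_boot.

Set Implicit Arguments.
Unset Strict Implicit.
Unset Printing Implicit Defensive.

(* The vertex set [m] = {1, ..., m} is represented by 'I_m = {0, ..., m-1};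
   only the order of the vertices matters. *)
Definition edge (m : nat) : finType := {e : 'I_m * 'I_m | e.1 < e.2}.

Definition left_end (m : nat) (e : edge m) : 'I_m := (val e).1.
Definition right_end (m : nat) (e : edge m) : 'I_m := (val e).2.
Definition ends (m : nat) (e : edge m) : {set 'I_m} :=
  [set left_end e; right_end e].

Definition independent (m : nat) (e f : edge m) : bool :=
  [disjoint ends e & ends f].

Definition separated (m : nat) (e f : edge m) : bool :=
  let: (a, b) := (left_end e, right_end e) in
  let: (c, d) := (left_end f, right_end f) in
  independent e f &&
  ([&& a < b, b < c & c < d] || [&& c < d, d < a & a < b]).

Definition matching (m : nat) (M : {set edge m}) : Prop :=
  {in M &, forall e f, e != f -> independent e f}.

Definition separated_matching (m : nat) (M : {set edge m}) : Prop :=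
  matching M /\ {in M &, forall e f, e != f -> separated e f}.

Definition monochromatic (m t : nat) (c : {ffun edge m -> 'I_t})
    (M : {set edge m}) : Prop :=
  {in M &, forall e f, c e = c f}.

Definition sep_arrow (t n m : nat) : Prop :=
  forall c : {ffun edge m -> 'I_t},
  exists M : {set edge m},
    [/\ separated_matching M, monochromatic c M & #|M| = n].

(* R_sep(t, n) = r, as a relation: this avoids building a proof that some m
   satisfies [sep_arrow t n] into the definition. *)
Definition is_Rsep (t n r : nat) : Prop :=
  sep_arrow t n r /\ (forall m : nat, sep_arrow t n m -> r <= m).

(* Main.v *)
Require Import Defs.
From mathcomp Require Import all_boot.
From mathcomp Require Import zify.

(** Upper bound: among the t(n-1)+1 pairwise separated edges (2i, 2i+1), n have
    the same color by the pigeonhole principle.  Lower bound: on at most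
    2t(n-1)+1 vertices, color an edge with left end a by the block of 2(n-1)
    consecutive vertices containing a.  The left ends of two separated edges
    differ by at least 2, so a block contains at most n-1 left ends of a
    separated matching. *)

Lemma pigeonhole_fiber (A B : finType) (f : A -> B) (n : nat) :
  #|B| * n < #|A| -> exists b, n < #|[set a | f a == b]|.
Proof.
move=> lt_BA; apply/existsP; apply: contraLR lt_BA.
rewrite negb_exists -leqNgt => /forallP small.
rewrite -sum1_card (partition_big f predT) //= -sum_nat_const.
apply: leq_sum => b _; rewrite sum1_card -cardsE.
by have := small b; rewrite -leqNgt.
Qed.

Lemma left_end_lt_right_end (m : nat) (e : edge m) : left_end e < right_end e.
Proof. exact: valP e. Qed.

(** Each edge has its left end before its right end, so the middle inequality of either chain
    implies the outer ones and the disjointness of the ends. *)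
Lemma separatedE (m : nat) (e f : edge m) :
  separated e f = (right_end e < left_end f) || (right_end f < left_end e).
Proof.
case: e => [[a b] /= ab]; case: f => [[c d] /= cd].
rewrite /separated /independent /ends /left_end /right_end /= ab cd andbT /=.
rewrite andbT; apply/andb_idl => sep.
rewrite disjoints_subset; apply/subsetP => x.
rewrite !inE => /orP[] /eqP ->; rewrite -!val_eqE /=; lia.
Qed.

Lemma separated_matchingP (m : nat) (M : {set edge m}) :
  {in M &, forall e f, e != f -> separated e f} -> separated_matching M.
Proof.
move=> sepM; split=> // e f eM fM /(sepM _ _ eM fM).
by case/andP.
Qed.

Lemma sep_arrow_upper (t n : nat) : sep_arrow t n.+1 (2 * (t * n + 1)).
Proof.
move=> c; set N := t * n + 1.
have lt0 (i : 'I_N) : 2 * i < 2 * N by have := ltn_ord i; lia.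
have lt1 (i : 'I_N) : (2 * i).+1 < 2 * N by have := ltn_ord i; lia.
pose E (i : 'I_N) : edge (2 * N) :=
  exist (fun e : 'I_(2 * N) * 'I_(2 * N) => e.1 < e.2)
    (Ordinal (lt0 i), Ordinal (lt1 i)) (ltnSn _).
have E_inj : injective E.
  by move=> i j /(congr1 (fun e => val (left_end e))) /= eq2; apply: val_inj => /=; lia.
have [|k] := @pigeonhole_fiber _ _ (c \o E) n.
  by rewrite !card_ord /N; lia.
(* The color class may have more than [n.+1] edges; [s] selects exactly [n.+1] of them. *)
case/card_geqP => s [uniq_s size_s sub_s].
exists (E @: [set i in s]); split.
- apply: separated_matchingP => _ _ /imsetP[i _ ->] /imsetP[j _ ->] neq.
  have {neq} : i != j by apply: contraNneq neq => ->.
  by rewrite -val_eqE separatedE /=; lia.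
- move=> _ _ /imsetP[i + ->] /imsetP[j + ->]; rewrite !inE => /sub_s + /sub_s.
  by rewrite !inE /= => /eqP -> /eqP ->.
- by rewrite card_imset // cardsE (card_uniqP uniq_s).
Qed.

Lemma sep_arrow_lower (t n m : nat) :
  0 < n -> sep_arrow t n.+1 m -> 2 * (t * n + 1) <= m.
Proof.
move=> n_gt0 arrow; rewrite leqNgt; apply/negP => lt_m.
(* The quotient is the index of the block of [2 * n] vertices. The last vertex is at most
   [2 * t * n] and is never a left end, so [t] blocks suffice. *)
have left_lt (e : edge m) : (left_end e)./2 %/ n < t.
  have := left_end_lt_right_end _ e; have := ltn_ord (right_end e).
  by rewrite ltn_divLR //; lia.
have [M [[_ sepM] monoM cardM]] := arrow [ffun e => Ordinal (left_lt e)].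
(* A block consists of [n] pairs of consecutive vertices; [residue] tells which pair contains the
   left end. *)
pose residue (e : edge m) : 'I_n := Ordinal (ltn_pmod (left_end e)./2 n_gt0).
have residue_inj : {in M &, injective residue}.
  move=> e f eM fM [eq_mod]; apply/eqP/negPn/negP => neq.
  have := monoM _ _ eM fM; rewrite !ffunE => -[eq_div].
  have eq_half : (left_end e)./2 = (left_end f)./2.
    by rewrite (divn_eq (left_end e)./2 n) eq_div eq_mod -divn_eq.
  (* A right end lies strictly between the two left ends, so their halves cannot agree. *)
  have := sepM _ _ eM fM neq; rewrite separatedE.
  have := left_end_lt_right_end _ e; have := left_end_lt_right_end _ f.
  by move: eq_half; lia.
have := max_card [in residue @: M].
by rewrite card_in_imset // cardM card_ord ltnn.
Qed.

Theorem theorem2p19 (t n : nat) (ht : 2 <= t) (hn : 2 <= n) :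
  is_Rsep t n (2 * (t * (n - 1) + 1)).
Proof.
case: n hn => // n n_gt0; rewrite subn1 /=.
split; first exact: sep_arrow_upper.
by move=> m; apply: sep_arrow_lower.
Qed.
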